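(* Let $\Bbbk$ be an algebraically closed field of arbitrary characteristic and let $n\ge 9$. The pull-backs, along all the projections $\pi_J:(\mathbb{P}^3)^n\to(\mathbb{P}^3)^7$ with $J\subseteq\{1,\dots,n\}$, $|J|=7$, of all multi-homogeneous polynomials vanishing on $V_{3,7}\subseteq(\mathbb{P}^3)^7$ do not cut out $V_{3,n}\subseteq(\mathbb{P}^3)^n$ set-theoretically (i.e. their common zero locus in $(\mathbb{P}^3)^n$ is not equal to $V_{3,n}$ as a set).
   Context: A rational normal curve in $\mathbb{P}^3$ (twisted cubic) is the image of the third Veronese embedding $\mathbb{P}^1\hookrightarrow\mathbb{P}^3$ up to projective automorphism. Let $U_{3,n}\subseteq(\mathbb{P}^3)^n$ be the locus of configurations $(p_1,\dots,p_n)$ of $n$ distinct points such that some rational normal curve in $\mathbb{P}^3$ contains all the $p_i$. $V_{3,n}\subseteq(\mathbb{P}^3)^n$ (the Veronese compactification) is the Zariski closure of $U_{3,n}$ with the reduced induced scheme structure. For $J\subseteq\{1,\dots,n\}$ with $|J|=7$, $\pi_J$ sends $(p_i)_{1\le i\le n}$ to $(p_i)_{i\in J}$ (indices in increasing order). *)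

(* Defs.v *)
From HB Require Import structures.
From mathcomp Require Import all_boot all_order all_algebra.
From mathcomp Require Import mpoly.

Set Implicit Arguments.
Unset Strict Implicit.
Unset Printing Implicit Defensive.

Import GRing.Theory.
Local Open Scope ring_scope.

(* Closed points of P^d, as lines through the origin of K^(d+1). *)
Definition pspace (K : fieldType) (d : nat) : Type :=
  {U : {vspace 'rV[K]_d.+1} | \dim U == 1%N}.

Definition multiproj (K : fieldType) (d n : nat) : Type :=
  {ffun 'I_n -> pspace K d}.

(* v is a vector of homogeneous coordinates of p. *)
Definition has_coords (K : fieldType) (d : nat) (p : pspace K d)
    (v : 'rV[K]_d.+1) : Prop :=
  v != 0 /\ v \in val p.

(* The multi-homogeneous coordinate ring of (P^d)^n: the j-th coordinate on the
   i-th factor is the variable 'X_(mxvec_index i j), so a polynomial is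
   evaluated at mxvec v, where row i of v holds coordinates of the i-th point. *)
Definition mcoord_ring (K : fieldType) (d n : nat) : Type :=
  {mpoly K[(n * d.+1)%N]}.

Definition multihomogeneous (K : fieldType) (d n : nat)
    (F : mcoord_ring K d n) : Prop :=
  exists e : 'I_n -> nat, forall m, m \in msupp F ->
    forall i, (\sum_(j < d.+1) m (mxvec_index i j))%N = e i.

(* For a multi-homogeneous F this does not depend on the choice of v. *)
Definition vanishes_at (K : fieldType) (d n : nat) (F : mcoord_ring K d n)
    (p : multiproj K d n) : Prop :=
  forall v : 'M[K]_(n, d.+1),
    (forall i, has_coords (p i) (row i v)) -> F.@[mxvec v 0] = 0.

Definition zero_locus (K : fieldType) (d n : nat)
    (S : mcoord_ring K d n -> Prop) (p : multiproj K d n) : Prop :=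
  forall F, S F -> vanishes_at F p.

Definition zariski_closed (K : fieldType) (d n : nat)
    (Z : multiproj K d n -> Prop) : Prop :=
  exists S : mcoord_ring K d n -> Prop,
    (forall F, S F -> multihomogeneous F) /\
    (forall p, Z p <-> zero_locus S p).

Definition zariski_closure (K : fieldType) (d n : nat)
    (A : multiproj K d n -> Prop) (p : multiproj K d n) : Prop :=
  forall Z : multiproj K d n -> Prop,
    zariski_closed Z -> (forall q, A q -> Z q) -> Z p.

(* [s : t] |-> [s^d : s^(d-1) t : ... : t^d], on homogeneous coordinates. *)
Definition veronese (K : fieldType) (d : nat) (x : 'rV[K]_2) : 'rV[K]_d.+1 :=
  \row_(j < d.+1) (x 0 0 ^+ (d - j) * x 0 1 ^+ j).

(* The automorphisms of P^d are induced by the invertible matrices A. *)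
Definition rational_normal_curve (K : fieldType) (d : nat)
    (C : pspace K d -> Prop) : Prop :=
  exists2 A : 'M[K]_d.+1, A \in unitmx &
    forall p, C p <->
      exists2 x : 'rV[K]_2, x != 0 & has_coords p (veronese d x *m A).

Definition on_rnc (K : fieldType) (d n : nat) (p : multiproj K d n) : Prop :=
  injective p /\
  exists2 C : pspace K d -> Prop, rational_normal_curve C & forall i, C (p i).

Definition veronese_compactification (K : fieldType) (d n : nat) :
    multiproj K d n -> Prop :=
  zariski_closure (@on_rnc K d n).

(* The a-th element of J in increasing order. *)
Definition nth_index (n m : nat) (J : {set 'I_n}) (hJ : #|J| = m) (a : 'I_m) :
    'I_n :=
  enum_val (cast_ord (esym hJ) a).

Definition proj_on (K : fieldType) (d n m : nat) (J : {set 'I_n})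
    (hJ : #|J| = m) (p : multiproj K d n) : multiproj K d m :=
  [ffun a => p (nth_index hJ a)].

(* Pull-back along proj_on hJ: the j-th coordinate of the a-th factor becomes
   the j-th coordinate of the factor indexed by the a-th element of J. *)
Definition pullback (K : fieldType) (d n m : nat) (J : {set 'I_n})
    (hJ : #|J| = m) (F : mcoord_ring K d m) : mcoord_ring K d n :=
  F \mPo [tuple mxvec (\matrix_(a < m, j < d.+1)
                   ('X_(mxvec_index (nth_index hJ a) j) : {mpoly K[(n * d.+1)%N]})) 0 k
         | k < (m * d.+1)%N].

Lemma vanishes_at_pullback (K : fieldType) (d n m : nat) (J : {set 'I_n})
    (hJ : #|J| = m) (F : mcoord_ring K d m) (p : multiproj K d n) :
  vanishes_at (pullback hJ F) p <-> vanishes_at F (proj_on hJ p).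
Proof.
have evE (v : 'M[K]_(n, d.+1)) : (pullback hJ F).@[mxvec v 0] =
    F.@[mxvec (\matrix_(a < m, j < d.+1) v (nth_index hJ a) j) 0].
  rewrite /pullback comp_mpoly_meval; apply: meval_eq => k.
  rewrite tnth_mktuple; case/mxvec_indexP: k => a j.
  by rewrite !mxvecE !mxE mevalXU mxvecE.
split=> hF v hv.
- pose w : 'M[K]_(n, d.+1) := \matrix_i
    if [pick a | nth_index hJ a == i] is Some a then row a v
    else vpick (val (p i)).
  have wE : (\matrix_(a < m, j < d.+1) w (nth_index hJ a) j) = v.
    apply/matrixP => a j; rewrite !mxE; case: pickP => [b /eqP|/(_ a)].
      by move/enum_val_inj/cast_ord_inj=> ->; rewrite mxE.
    by rewrite eqxx.
  rewrite -[in LHS]wE -evE; apply: hF => i; rewrite rowK.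
  case: pickP => [a /eqP <-|_]; first by have := hv a; rewrite ffunE.
  split; last exact: memv_pick.
  by rewrite vpick0 -dimv_eq0 (eqP (valP (p i))).
- rewrite evE; apply: hF => a.
  have -> : row a (\matrix_(b < m, j < d.+1) v (nth_index hJ b) j) =
            row (nth_index hJ a) v by apply/rowP => j; rewrite !mxE.
  by rewrite ffunE; exact: hv.
Qed.

Definition pulled_back_equations (K : fieldType) (d n m : nat)
    (V : multiproj K d m -> Prop) (G : mcoord_ring K d n) : Prop :=
  exists (J : {set 'I_n}) (hJ : #|J| = m) (F : mcoord_ring K d m),
    [/\ multihomogeneous F, forall q, V q -> vanishes_at F q
      & G = pullback hJ F].

(* Main.v *)
Require Import Defs.
From mathcomp Require Import all_boot all_order all_algebra.
From mathcomp Require Import mpoly.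
From mathcomp Require Import ring zify.

(** The statement fails because of configurations contained in a plane.

    Planar 7-tuples lie in V_{3,7}.  A cubic of the plane with a node at
    the first point and passing through six further points has 7 coefficients
    subject to 6 linear conditions, so it exists; projecting from the node
    parametrizes it by cubic binary forms, that is, by the Veronese map followed
    by a linear map of rank at most 3 (nodal_cubic_param).  For generic points
    this parametrization hits all seven of them.  A singular matrix is a limit of
    invertible ones, hence a polynomial vanishing on the 7-tuples carried by
    twisted cubics also vanishes on those images (vanishing_extends), and then on
    arbitrary planar 7-tuples; it is enough to treat those whose first point has a
    nonzero third coordinate (planar_vanishing).  All limits are taken along lines, where they
    say that a polynomial in one variable vanishing at almost all points is zero.

    On the other hand, planar n-tuples with n >= 9 are in general not in
    V_{3,n}: only the first three coordinates matter, and up to scaling each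
    point, the projections to the plane of n points of a twisted cubic are
    described by n + 8 parameters (11 for the cubic parametrization up to a
    factor, n - 3 for the points once three of them sit at the parameters
    0, infinity and 1), whereas n points of the plane depend on 2n > n + 8
    parameters.  Counting monomials turns this into a nonzero multi-homogeneous
    form that vanishes on all configurations lying on a twisted cubic
    (twisted_cubic_relation, on_rnc_relation).  The monomials of this form are
    numbered by integers m < N^(2n) through their exponents, the digits of m in
    base N; at the points (u^(N^(2i)) : u^(N^(2i+1)) : 1 : 0) the m-th one takes
    the value u^m, so the form becomes a nonzero polynomial in u and a general u
    gives a planar configuration outside V_{3,n}. *)

Set Implicit Arguments.
Unset Strict Implicit.
Unset Printing Implicit Defensive.

Import GRing.Theory.

(** * Density along a line *)

Section PolynomialFunctions.
Local Open Scope ring_scope.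

Variable K : closedFieldType.

Definition polyfun (f : K -> K) : Prop :=
  exists P : {poly K}, forall t, f t = P.[t].

Lemma polyfun_const c : polyfun (fun _ => c).
Proof. by exists c%:P => t; rewrite hornerC. Qed.

Lemma polyfun_id : polyfun id.
Proof. by exists 'X => t; rewrite hornerX. Qed.

Lemma polyfunD f g : polyfun f -> polyfun g -> polyfun (fun t => f t + g t).
Proof. by case=> P fP [Q gQ]; exists (P + Q) => t; rewrite hornerD fP gQ. Qed.

Lemma polyfunM f g : polyfun f -> polyfun g -> polyfun (fun t => f t * g t).
Proof. by case=> P fP [Q gQ]; exists (P * Q) => t; rewrite hornerM fP gQ. Qed.

Lemma polyfunB f g : polyfun f -> polyfun g -> polyfun (fun t => f t - g t).
Proof. by case=> P fP [Q gQ]; exists (P - Q) => t; rewrite hornerD hornerN fP gQ. Qed.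

Lemma polyfunX f k : polyfun f -> polyfun (fun t => f t ^+ k).
Proof. by case=> P fP; exists (P ^+ k) => t; rewrite horner_exp fP. Qed.

Lemma polyfun_sum (I : finType) (P : pred I) (f : I -> K -> K) :
  (forall i, polyfun (f i)) -> polyfun (fun t => \sum_(i | P i) f i t).
Proof.
move=> hf; have [Q hQ] := fin_all_exists hf.
by exists (\sum_(i | P i) Q i) => t; rewrite horner_sum; apply: eq_bigr => i _.
Qed.

Lemma polyfun_prod (I : finType) (P : pred I) (f : I -> K -> K) :
  (forall i, polyfun (f i)) -> polyfun (fun t => \prod_(i | P i) f i t).
Proof.
move=> hf; have [Q hQ] := fin_all_exists hf.
by exists (\prod_(i | P i) Q i) => t; rewrite horner_prod; apply: eq_bigr => i _.
Qed.

Lemma polyfun_det m (M : K -> 'M[K]_m) :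
  (forall i j, polyfun (fun t => M t i j)) -> polyfun (fun t => \det (M t)).
Proof.
move=> hM; rewrite /determinant; apply: polyfun_sum => s.
by apply: polyfunM; [exact: polyfun_const | exact: polyfun_prod].
Qed.

Lemma polyfun_meval m (H : {mpoly K[m]}) (v : K -> 'I_m -> K) :
  (forall k, polyfun (fun t => v t k)) -> polyfun (fun t => H.@[v t]).
Proof.
move=> hv; have [Q hQ] := fin_all_exists hv.
exists (\sum_(mu <- msupp H) (H@_mu)%:P * \prod_i Q i ^+ mu i) => t.
rewrite mevalE horner_sum; apply: eq_bigr => mu _.
rewrite hornerM hornerC horner_prod; congr (_ * _).
by apply: eq_bigr => i _; rewrite horner_exp hQ.
Qed.

Lemma polyfun_mulmx a b c (M : K -> 'M[K]_(a, b)) (N : K -> 'M[K]_(b, c)) i j :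
  (forall i j, polyfun (fun t => M t i j)) ->
  (forall i j, polyfun (fun t => N t i j)) ->
  polyfun (fun t => (M t *m N t) i j).
Proof.
move=> hM hN; pose f t := \sum_k M t i k * N t k j.
have [P hP] : polyfun f by apply: polyfun_sum => k; apply: polyfunM.
by exists P => t; rewrite mxE -hP.
Qed.

Lemma polyfun_line (a b : K) : polyfun (fun t => (1 - t) * a + t * b).
Proof.
apply: polyfunD; apply: polyfunM; try exact: polyfun_const; last exact: polyfun_id.
by apply: polyfunB; [exact: polyfun_const | exact: polyfun_id].
Qed.

Lemma eq_polyfun f g : f =1 g -> polyfun f -> polyfun g.
Proof. by move=> fg [P hP]; exists P => t; rewrite -fg. Qed.

(** The product f * d is a polynomial without nonzero values, and the field is
    infinite; this is how every Zariski-density argument below is carried out. *)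
Lemma polyfun_density (f d : K -> K) (t0 : K) :
  polyfun f -> polyfun d -> d t0 != 0 ->
  (forall t, d t != 0 -> f t = 0) -> forall t, f t = 0.
Proof.
case=> P hP [D hD] d0 fd0 t; rewrite hP.
have Dn0 : D != 0 by apply: contraNneq d0 => D0; rewrite hD D0 horner0.
suff : P * D == 0 by rewrite mulf_eq0 (negPf Dn0) orbF => /eqP ->; rewrite horner0.
apply: contraT => /closed_nonrootP[s]; rewrite /root hornerM mulf_eq0 negb_or.
by rewrite -hP -hD => /andP[fs ds]; rewrite fd0 ?eqxx in fs.
Qed.

(** An algebraically closed field is infinite. *)
Lemma distinct_elements m : exists a : 'I_m -> K, injective a.
Proof.
suff [s us ss] : exists2 s : seq K, uniq s & size s = m.
  exists (fun i => s`_i) => i j /eqP.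
  by rewrite nth_uniq ?ss ?ltn_ord // => /eqP/val_inj.
elim: m => [|m [s us ss]]; first by exists [::].
have : \prod_(x <- s) ('X - x%:P) != 0 by rewrite monic_neq0 ?monic_prod_XsubC.
case/closed_nonrootP=> x; rewrite root_prod_XsubC => xs.
by exists (x :: s); rewrite /= ?xs ?ss.
Qed.

Lemma left_kernel_nontrivial (m n : nat) (M : 'M[K]_(m, n)) : (n < m)%N ->
  exists2 c : 'rV[K]_m, c != 0 & c *m M = 0.
Proof.
move=> nm; have : kermx M != 0.
  rewrite -mxrank_eq0 mxrank_ker subn_eq0 -ltnNge.
  exact: leq_ltn_trans (rank_leq_col M) nm.
by case/rowV0Pn=> c /sub_kermxP cM c0; exists c.
Qed.

End PolynomialFunctions.

(** * Configurations on twisted cubics, in coordinates *)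

Section TwistedCubics.
Local Open Scope ring_scope.

Variable K : closedFieldType.

Lemma has_coords_line d (p : pspace K d) v : has_coords p v -> val p = <[v]>%VS.
Proof.
case=> v0 vp; apply/esym/eqP; rewrite eqEdim; apply/andP; split.
  by apply/subvP => w /vlineP[k ->]; exact: memvZ.
by rewrite (eqP (valP p)) dim_vline v0.
Qed.

Lemma exists_point d (v : 'rV[K]_d.+1) : v != 0 -> exists p : pspace K d, has_coords p v.
Proof.
move=> v0; have dv : \dim <[v]> == 1%N by rewrite dim_vline v0.
by exists (exist (fun U : {vspace 'rV[K]_d.+1} => \dim U == 1%N) <[v]>%VS dv);
  split; rewrite //= memv_line.
Qed.

Lemma has_coordsZ d (p : pspace K d) v k : k != 0 -> has_coords p v -> has_coords p (k *: v).
Proof. by move=> k0 [v0 vp]; split; rewrite ?scaler_eq0 ?negb_or ?k0 ?memvZ. Qed.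

Lemma has_coords_prop d (p : pspace K d) v w :
  has_coords p v -> has_coords p w -> exists2 k, k != 0 & w = k *: v.
Proof.
move=> /has_coords_line pv [w0]; rewrite pv => /vlineP[k wk]; exists k => //.
by apply: contraNneq w0 => k0; rewrite wk k0 scale0r.
Qed.

Lemma has_coords_inj d (p q : pspace K d) v : has_coords p v -> has_coords q v -> p = q.
Proof. by move=> /has_coords_line pv /has_coords_line qv; apply/val_inj; rewrite pv. Qed.

Definition wedge (x y : 'rV[K]_2) : K := x 0 0 * y 0 1 - x 0 1 * y 0 0.

Lemma rV2P (x y : 'rV[K]_2) : x 0 0 = y 0 0 -> x 0 1 = y 0 1 -> x = y.
Proof.
move=> e0 e1; apply/rowP => -[[|[|//]] hj].
  by rewrite (_ : Ordinal hj = 0) //; exact: val_inj.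
by rewrite (_ : Ordinal hj = 1) //; exact: val_inj.
Qed.

Lemma rV2_neq0 (x : 'rV[K]_2) : (x != 0) = (x 0 0 != 0) || (x 0 1 != 0).
Proof.
apply/idP/idP; last first.
  by apply: contraTneq => ->; rewrite !mxE eqxx.
apply: contraNT; rewrite negb_or !negbK => /andP[/eqP x0 /eqP x1].
by apply/eqP/rV2P; rewrite mxE.
Qed.

Lemma wedge_eq0 (x y : 'rV[K]_2) : x != 0 -> y != 0 -> wedge x y = 0 ->
  exists2 k, k != 0 & y = k *: x.
Proof.
rewrite !rV2_neq0 => hx hy /eqP; rewrite subr_eq0 => /eqP w0.
have [x0|x0] := eqVneq (x 0 0) 0.
  rewrite x0 eqxx /= in hx; rewrite x0 mul0r in w0.
  have y0 : y 0 0 = 0.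
    by move/esym/eqP: w0; rewrite mulf_eq0 (negPf hx) => /eqP.
  rewrite y0 eqxx /= in hy.
  exists (y 0 1 / x 0 1); first by rewrite mulf_neq0 ?invr_eq0.
  by apply/rV2P; rewrite !mxE ?divfK // x0 y0 mulr0.
have y0 : y 0 0 != 0.
  apply: contraTneq hy => y0; rewrite y0 mulr0 in w0.
  by move/eqP: w0; rewrite mulf_eq0 (negPf x0) y0 => /= ->; rewrite eqxx.
exists (y 0 0 / x 0 0); first by rewrite mulf_neq0 ?invr_eq0.
apply/rV2P; rewrite !mxE ?divfK //.
by rewrite mulrAC [y 0 0 * _]mulrC -w0 mulrAC divff ?mul1r.
Qed.

Lemma veroneseZ (k : K) x : veronese 3 (k *: x) = k ^+ 3 *: veronese 3 x.
Proof.
apply/rowP => j; rewrite !mxE !exprMn mulrACA -exprD subnK //.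
by rewrite -ltnS.
Qed.

Lemma veronese_entries (x : 'rV[K]_2) (j : 'I_4) :
  veronese 3 x 0 j = [:: x 0 0 ^+ 3; x 0 0 ^+ 2 * x 0 1; x 0 0 * x 0 1 ^+ 2; x 0 1 ^+ 3]`_j.
Proof. by case: j => [[|[|[|[|//]]]] hj]; rewrite mxE /= ?expr0 ?expr1 ?mulr1 ?mul1r. Qed.

Lemma veronese_neq0 x : x != 0 -> veronese (K:=K) 3 x != 0.
Proof.
rewrite rV2_neq0; apply: contraTneq => v0.
have := veronese_entries x 0; have := veronese_entries x ord_max.
rewrite v0 !mxE /= => /esym/eqP; rewrite expf_eq0 => /eqP -> /esym/eqP.
by rewrite expf_eq0 => /eqP ->; rewrite eqxx.
Qed.

(** The Veronese map is injective on the projective line: the ratio of the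
    coordinates of x can be read off two consecutive coordinates of its image. *)
Lemma veronese_wedge (k : K) x y : x != 0 -> y != 0 ->
  veronese 3 x = k *: veronese 3 y -> wedge x y = 0.
Proof.
rewrite !rV2_neq0 => hx hy e.
have E j : veronese 3 x 0 j = k * veronese 3 y 0 j by rewrite e mxE.
have := E 0; have := E 1; have := E (inord 2); have := E ord_max.
rewrite !veronese_entries /= inordK //= /wedge.
move: (x 0 0) (x 0 1) (y 0 0) (y 0 1) hx hy => s t s' t' hx hy e3 e2 e1 e0.
have [s0|s0] := eqVneq s 0.
  rewrite s0 eqxx /= in hx; move: e0 e1; rewrite s0 !expr0n /= !mul0r.
  have k0 : k != 0.
    by apply: contraNneq hx => k0; rewrite k0 mul0r in e3; move/eqP: e3; rewrite expf_eq0.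
  move/esym/eqP; rewrite mulf_eq0 (negPf k0) expf_eq0 /= => /eqP -> _.
  by rewrite mulr0 subr0.
have k0 : k != 0.
  by apply: contraNneq s0 => k0; rewrite k0 mul0r in e0; move/eqP: e0; rewrite expf_eq0.
have s'0 : s' != 0.
  by apply: contraNneq s0 => s'0; rewrite s'0 expr0n mulr0 in e0; move/eqP: e0; rewrite expf_eq0.
have : s ^+ 2 * s' ^+ 2 * k * (s * t' - t * s') == 0.
  apply/eqP.
  transitivity (s ^+ 3 * (k * (s' ^+ 2 * t')) - (s ^+ 2 * t) * (k * s' ^+ 3)); first by ring.
  by rewrite -e0 -e1; ring.
have c0 : s ^+ 2 * s' ^+ 2 * k != 0 by rewrite !mulf_neq0 ?expf_neq0.
by rewrite mulf_eq0 (negPf c0) => /eqP.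
Qed.

(** Distinctness of the points becomes pairwise independence of their parameters,
    which, unlike injectivity, is an algebraic condition. *)
Lemma on_rncP n (p : multiproj K 3 n) :
  on_rnc p -> exists (A : 'M[K]_4) (x : 'I_n -> 'rV[K]_2),
    [/\ forall i, x i != 0, forall i j, i != j -> wedge (x i) (x j) != 0
      & forall i, has_coords (p i) (veronese 3 (x i) *m A)].
Proof.
case=> pinj [C [A Au CA] pC].
have [x hx] : exists x : 'I_n -> 'rV[K]_2, forall i,
    x i != 0 /\ has_coords (p i) (veronese 3 (x i) *m A).
  by apply: (@fin_all_exists _ _ (fun i y => y != 0 /\ has_coords (p i) (veronese 3 y *m A))) => i;
     have [y y0 hy] := (CA (p i)).1 (pC i); exists y.
exists A, x; split=> [i|i j|i]; try by case: (hx i).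
apply: contra_neq => /wedge_eq0 - /(_ (hx i).1 (hx j).1)[k k0 xij].
apply: pinj; apply: (has_coords_inj (v := veronese 3 (x j) *m A)); last by case: (hx j).
by rewrite xij veroneseZ -scalemxAl; apply: has_coordsZ; [rewrite expf_neq0 | case: (hx i)].
Qed.

Lemma on_rnc_coords n (A : 'M[K]_4) (x : 'I_n -> 'rV[K]_2) :
  A \in unitmx -> (forall i, x i != 0) ->
  (forall i j, i != j -> wedge (x i) (x j) != 0) ->
  exists2 p : multiproj K 3 n, on_rnc p &
    forall i, has_coords (p i) (veronese 3 (x i) *m A).
Proof.
move=> Au x0 xw.
have vn0 i : veronese 3 (x i) *m A != 0.
  apply: contraNneq (veronese_neq0 (x0 i)) => /(congr1 (mulmx^~ (invmx A))).
  by rewrite /= mulmxK // mul0mx => ->.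
have [p hp] : exists p : 'I_n -> pspace K 3, forall i,
    has_coords (p i) (veronese 3 (x i) *m A).
  apply: (@fin_all_exists _ _ (fun i y => has_coords y (veronese 3 (x i) *m A))) => i.
  exact: exists_point.
exists (finfun p); last by move=> i; rewrite ffunE.
split; last first.
  exists (fun q => exists2 y : 'rV[K]_2, y != 0 & has_coords q (veronese 3 y *m A)).
    by exists A.
  by move=> i; rewrite ffunE; exists (x i).
move=> i j; rewrite !ffunE => pij; apply: contraTeq isT => /xw.
have := hp i; rewrite pij => hi; have [k _] := has_coords_prop (hp j) hi.
rewrite scalemxAl => /(congr1 (mulmx^~ (invmx A))); rewrite /= !mulmxK //.
by move/(veronese_wedge (x0 i) (x0 j)) => ->; rewrite eqxx.
Qed.

End TwistedCubics.

(** * Planar seven-tuples as limits of points on twisted cubics *)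

Section DegenerateCubics.
Local Open Scope ring_scope.

Variable K : closedFieldType.

(** The parametrization of configurations on twisted cubics has an irreducible
    source, in which the conditions that A is invertible and that the parameters
    are distinct are open.  Joining (x, A) by a line to a point satisfying them
    removes both; rank-deficient A then produce degenerate cubics. *)
Lemma vanishing_extends (n : nat) (H : mcoord_ring K 3 n) :
  (forall p, on_rnc p -> vanishes_at H p) ->
  forall (x : 'I_n -> 'rV[K]_2) (A : 'M[K]_4) (l : 'I_n -> K),
    (forall i, l i != 0) ->
    H.@[mxvec (\matrix_i (l i *: (veronese 3 (x i) *m A))) 0] = 0.
Proof.
move=> hH x A l l0.
have [a ainj] := distinct_elements K n.
pose ys i : 'rV[K]_2 := \row_j (if j == 0 then 1 else a i).
pose X t i := (1 - t) *: x i + t *: ys i.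
pose B t := (1 - t) *: A + t *: (1%:M : 'M[K]_4).
pose W t : 'M[K]_(n, 4) := \matrix_i (l i *: (veronese 3 (X t i) *m B t)).
pose d t := \det (B t) * (\prod_i X t i 0 0) *
            \prod_i \prod_(j | j != i) wedge (X t i) (X t j).
have pX i j : polyfun (fun t => X t i 0 j).
  by apply: eq_polyfun (polyfun_line (x i 0 j) (ys i 0 j)) => t; rewrite !mxE.
have pB i j : polyfun (fun t => B t i j).
  by apply: eq_polyfun (polyfun_line (A i j) ((1%:M : 'M_4) i j)) => t; rewrite !mxE.
have X1 i : X 1 i = ys i by rewrite /X subrr scale0r add0r scale1r.
have B1 : B 1 = 1%:M by rewrite /B subrr scale0r add0r scale1r.
have pW k : polyfun (fun t => mxvec (W t) 0 k).
  case/mxvec_indexP: k => i j.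
  apply: (@eq_polyfun _ (fun t => l i * (veronese 3 (X t i) *m B t) 0 j)).
    by move=> t; rewrite mxvecE !mxE.
  apply: polyfunM; first exact: polyfun_const.
  apply: polyfun_mulmx => // i' k; rewrite (ord1 i').
  apply: (@eq_polyfun _ (fun t => X t i 0 0 ^+ (3 - k) * X t i 0 1 ^+ k)).
    by move=> t; rewrite !mxE.
  by apply: polyfunM; apply: polyfunX.
have pd : polyfun d.
  apply: polyfunM; first by apply: polyfunM; [exact: polyfun_det | exact: polyfun_prod].
  apply: polyfun_prod => i; apply: polyfun_prod => j.
  by apply: polyfunB; apply: polyfunM.
have d1 : d 1 != 0.
  rewrite /d B1 det1 mul1r mulf_neq0 //.
    by apply/prodf_neq0 => i _; rewrite X1 mxE oner_neq0.
  apply/prodf_neq0 => i _; apply/prodf_neq0 => j ji.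
  by rewrite !X1 /wedge !mxE /= mul1r mulr1 subr_eq0 (inj_eq ainj).
have key t : d t != 0 -> H.@[mxvec (W t) 0] = 0.
  rewrite /d !mulf_eq0 !negb_or => /andP[/andP[Bt /prodf_neq0 Xt] /prodf_neq0 wt].
  have [|i|i j ij|p pU pc] := @on_rnc_coords K n (B t) (X t).
  - by rewrite unitmxE unitfE.
  - by rewrite rV2_neq0 Xt.
  - have /prodf_neq0/(_ j) := wt i isT; rewrite eq_sym; exact.
  by apply: (hH p pU) => i; rewrite rowK; apply: has_coordsZ.
have := polyfun_density (polyfun_meval H pW) pd d1 key 0.
rewrite (_ : W 0 = \matrix_i (l i *: (veronese 3 (x i) *m A))) //.
by apply/row_matrixP => i; rewrite !rowK /X /B !subr0 !scale0r !addr0 !scale1r.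
Qed.

(** The values of the monomials spanning the conics through (0 : 0 : 1). *)
Definition conic_mx m (x y z : 'I_m -> K) : 'M[K]_(5, m) :=
  \matrix_(a, i) [:: x i ^+ 2; x i * y i; y i ^+ 2; z i * x i; z i * y i]`_a.

(** The values of the monomials spanning the plane cubics singular at (0 : 0 : 1). *)
Definition nodal_mx m (x y z : 'I_m -> K) : 'M[K]_(7, m) :=
  \matrix_(a, i) [:: z i * x i ^+ 2; z i * (x i * y i); z i * y i ^+ 2;
    x i ^+ 3; x i ^+ 2 * y i; x i * y i ^+ 2; y i ^+ 3]`_a.

Lemma sum_ord_iota n (f : 'I_n.+1 -> K) :
  \sum_i f i = \sum_(k <- iota 0 n.+1) f (inord k).
Proof.
rewrite -[iota 0 n.+1]/(index_iota 0 n.+1) big_mkord.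
by apply: eq_bigr => i _; rewrite inord_val.
Qed.

(** A binary form vanishing at (s : t) is divisible by the linear form t X - s Y;
    b0 X + b1 Y is the quotient. *)
Lemma binary_quadratic_factor (s t a0 a1 a2 : K) : (s != 0) || (t != 0) ->
  a0 * s ^+ 2 + a1 * (s * t) + a2 * t ^+ 2 = 0 ->
  exists b0 b1, [/\ a0 = t * b0, a1 = t * b1 - s * b0 & a2 = - (s * b1)].
Proof.
move=> st e; have [t0|t0] := eqVneq t 0.
  rewrite t0 eqxx orbF in st.
  have a00 : a0 = 0.
    apply/eqP; move/eqP: e; rewrite t0 !(mulr0, expr0n) /= ?mulr0 !addr0.
    by rewrite mulf_eq0 expf_eq0 /= (negPf st) orbF.
  by exists (- a1 / s), (- a2 / s); rewrite t0 a00; split; field.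
exists (a0 / t), ((a1 + s * (a0 / t)) / t); split; try by field.
apply/eqP; rewrite -subr_eq0 -(mulIr_eq0 _ (mulIf (expf_neq0 2 t0))) -e.
by apply/eqP; field.
Qed.

Lemma binary_cubic_factor (s t a0 a1 a2 a3 : K) : (s != 0) || (t != 0) ->
  a0 * s ^+ 3 + a1 * (s ^+ 2 * t) + a2 * (s * t ^+ 2) + a3 * t ^+ 3 = 0 ->
  exists b0 b1 b2,
    [/\ a0 = t * b0, a1 = t * b1 - s * b0, a2 = t * b2 - s * b1 & a3 = - (s * b2)].
Proof.
move=> st e; have [t0|t0] := eqVneq t 0.
  rewrite t0 eqxx orbF in st.
  have a00 : a0 = 0.
    apply/eqP; move/eqP: e; rewrite t0 !(mulr0, expr0n) /= ?mulr0 !addr0.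
    by rewrite mulf_eq0 expf_eq0 /= (negPf st) orbF.
  by exists (- a1 / s), (- a2 / s), (- a3 / s); rewrite t0 a00; split; field.
exists (a0 / t), ((a1 + s * (a0 / t)) / t), ((a2 + s * ((a1 + s * (a0 / t)) / t)) / t).
split; try by field.
apply/eqP; rewrite -subr_eq0 -(mulIr_eq0 _ (mulIf (expf_neq0 3 t0))) -e.
by apply/eqP; field.
Qed.

Lemma binary_quadratic_root (a0 a1 a2 : K) :
  exists s t, (s != 0) || (t != 0) /\ a0 * s ^+ 2 + a1 * (s * t) + a2 * t ^+ 2 = 0.
Proof.
have [a00|a00] := eqVneq a0 0.
  by exists 1, 0; rewrite oner_eq0 a00 !(mulr0, mul0r, expr0n) /= !addr0.
have [s hs] := @solve_monicpoly K 2 (fun i => if i == 0%N then - a2 / a0 else - a1 / a0) isT.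
exists s, 1; rewrite oner_eq0 orbT hs !big_ord_recl big_ord0 /=; split=> //.
by rewrite /bump /=; field.
Qed.

Section SixPoints.
Variables x y z : 'I_6 -> K.
Hypothesis xy_indep : forall i j, i != j -> x i * y j - y i * x j != 0.
Hypothesis conic_indep : forall k,
  \det (conic_mx (x \o lift k) (y \o lift k) (z \o lift k)) != 0.

(** A common root of the quadratic and the cubic parts means that the nodal cubic
    contains a line through the node.  This line carries at most one of the six
    points, so the residual conic, which passes through the node, contains the
    five others: conic_indep forces its equation, hence the cubic, to be zero. *)
Lemma no_common_root (a0 a1 a2 c0 c1 c2 c3 : K) (s t : K) :
  (forall i, z i * (a0 * x i ^+ 2 + a1 * (x i * y i) + a2 * y i ^+ 2) +
    (c0 * x i ^+ 3 + c1 * (x i ^+ 2 * y i) + c2 * (x i * y i ^+ 2) + c3 * y i ^+ 3) = 0) ->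
  (s != 0) || (t != 0) ->
  a0 * s ^+ 2 + a1 * (s * t) + a2 * t ^+ 2 = 0 ->
  c0 * s ^+ 3 + c1 * (s ^+ 2 * t) + c2 * (s * t ^+ 2) + c3 * t ^+ 3 = 0 ->
  [/\ a0 = 0, a1 = 0 & a2 = 0] /\ [/\ c0 = 0, c1 = 0, c2 = 0 & c3 = 0].
Proof.
move=> h st /(binary_quadratic_factor st)[b0 [b1 [A0 A1 A2]]].
move=> /(binary_cubic_factor st)[e0 [e1 [e2 [C0 C1 C2 C3]]]]; subst.
suff [-> -> -> -> ->] : [/\ e0 = 0, e1 = 0, e2 = 0, b0 = 0 & b1 = 0].
  by rewrite !mulr0 !subr0 !oppr0.
pose L i := t * x i - s * y i.
have hL i : L i * (e0 * x i ^+ 2 + e1 * (x i * y i) + e2 * y i ^+ 2 +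
                   b0 * (z i * x i) + b1 * (z i * y i)) = 0.
  by rewrite -[RHS](h i) /L; ring.
(* Two points on the line L = 0 would be aligned with the node. *)
have [k hk] : exists k, forall i, i != k -> L i != 0.
  have [k /eqP k0|L0] := pickP (fun i => L i == 0); last by exists ord0 => i _; rewrite L0.
  exists k => i ik; apply: contraTneq st => i0.
  have := xy_indep ik; rewrite negb_or !negbK => w0.
  apply/andP; split.
    have : s * (x i * y k - y i * x k) = 0.
      by transitivity (L k * x i * -1 + L i * x k); [rewrite /L; ring | rewrite k0 i0; ring].
    by move/eqP; rewrite mulf_eq0 (negPf w0) orbF.
  have : t * (x i * y k - y i * x k) = 0.
    by transitivity (L i * y k - L k * y i); [rewrite /L; ring | rewrite k0 i0; ring].
  by move/eqP; rewrite mulf_eq0 (negPf w0) orbF.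
pose b : 'rV[K]_5 := \row_a [:: e0; e1; e2; b0; b1]`_a.
pose M := conic_mx (x \o lift k) (y \o lift k) (z \o lift k).
have bM : b *m M = 0.
  apply/rowP => i; rewrite !mxE !big_ord_recl big_ord0 !mxE /=.
  have /eqP := hL (lift k i); rewrite mulf_eq0 (negPf (hk _ _)) ?(eq_sym _ k) ?neq_lift //=.
  by move/eqP => E0; rewrite -[RHS]E0 addr0 !addrA.
have b0_ : b = 0.
  have Mu : M \in unitmx by rewrite unitmxE unitfE conic_indep.
  by rewrite -[b](mulmxK Mu) bM mul0mx.
have E (a : 'I_5) : [:: e0; e1; e2; b0; b1]`_a = 0.
  by have := congr1 (fun r : 'rV_5 => r 0 a) b0_; rewrite !mxE.
have := (E 0, E 1, E (inord 2), E (inord 3), E (inord 4)).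
by rewrite !inordK //= => -[[[[]]]].
Qed.

(** The plane is the one where the fourth coordinate vanishes, and the first of
    the seven points is the node. *)
Definition node_config : 'M[K]_(7, 4) := \matrix_i
  if unlift ord0 i is Some k then \row_j [:: x k; y k; z k; 0]`_j
  else \row_j [:: 0; 0; 1; 0]`_j.

(** The cubic z Q(x,y) + C(x,y) = 0 is parametrized by (s Q : t Q : - C), as the
    line of direction (s : t) through the node meets it in one other point.  The
    node itself is reached at a root of Q. *)
Lemma nodal_cubic_param : exists (A : 'M[K]_4) (xi : 'I_7 -> 'rV[K]_2) (l : 'I_7 -> K),
  (forall i, l i != 0) /\ node_config = \matrix_i (l i *: (veronese 3 (xi i) *m A)).
Proof.
have [c c0 hc] := left_kernel_nontrivial (nodal_mx x y z) isT.
pose e k := c 0 (inord k).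
pose Q s t := e 0%N * s ^+ 2 + e 1%N * (s * t) + e 2%N * t ^+ 2.
pose C s t := e 3%N * s ^+ 3 + e 4%N * (s ^+ 2 * t) + e 5%N * (s * t ^+ 2) + e 6%N * t ^+ 3.
have hQC i : z i * Q (x i) (y i) + C (x i) (y i) = 0.
  have := congr1 (fun r : 'rV_6 => r 0 i) hc; rewrite !mxE => E0; rewrite -[RHS]E0.
  rewrite sum_ord_iota /= !big_cons big_nil addr0 !mxE !inordK //= /Q /C.
  rewrite /e; ring.
have QC0 s t : (s != 0) || (t != 0) -> Q s t = 0 -> C s t != 0.
  move=> st Qst; apply: contraNneq c0 => Cst.
  have [[e0 e1 e2] [e3 e4 e5 e6]] := no_common_root hQC st Qst Cst.
  apply/eqP/rowP => k; rewrite mxE -(inord_val k) -/(e k).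
  by case: k => [[|[|[|[|[|[|[|//]]]]]]] hk].
have xy0 i : (x i != 0) || (y i != 0).
  have := xy_indep (neq_lift i ord0); apply: contraNT.
  by rewrite negb_or !negbK => /andP[/eqP -> /eqP ->]; rewrite !mul0r subrr.
have Q0 i : Q (x i) (y i) != 0.
  apply/eqP => Qi; have := QC0 _ _ (xy0 i) Qi.
  by have := hQC i; rewrite Qi mulr0 add0r => ->; rewrite eqxx.
have [s [t [st Qst]]] := binary_quadratic_root (e 0%N) (e 1%N) (e 2%N).
rewrite -[_ = 0]/(Q s t = 0) in Qst; have Cst := QC0 _ _ st Qst.
pose A : 'M[K]_4 := \matrix_(i, j) (nth [::] [:: [:: e 0%N; 0; - e 3%N; 0];
   [:: e 1%N; e 0%N; - e 4%N; 0]; [:: e 2%N; e 1%N; - e 5%N; 0]; [:: 0; e 2%N; - e 6%N; 0]] i)`_j.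
have AE (v : 'rV[K]_2) (u := v 0 0) (w := v 0 1) : veronese 3 v *m A =
    \row_j [:: Q u w * u; Q u w * w; - C u w; 0]`_j.
  apply/rowP => j; rewrite !mxE sum_ord_iota /= !big_cons big_nil addr0.
  rewrite !veronese_entries !mxE !inordK //= -/u -/w /Q /C.
  by case: j => [[|[|[|[|//]]]] hj] /=; ring.
exists A,
  (fun i => if unlift ord0 i is Some k then \row_j [:: x k; y k]`_j else \row_j [:: s; t]`_j),
  (fun i => if unlift ord0 i is Some k then (Q (x k) (y k))^-1 else - (C s t)^-1).
split=> [i|]; first by case: unliftP => [k _|_]; rewrite ?oppr_eq0 invr_eq0.
apply/row_matrixP => i; rewrite !rowK.
case: unliftP => [k _|_]; rewrite AE; apply/rowP => j; rewrite !mxE /=.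
  have -> : - C (x k) (y k) = z k * Q (x k) (y k) by apply/eqP; rewrite eq_sym -subr_eq0 opprK hQC.
  by case: j => [[|[|[|[|//]]]] hj] /=; field.
by rewrite Qst; case: j => [[|[|[|[|//]]]] hj] /=; field.
Qed.

End SixPoints.

(** A linear change of coordinates of the plane puts the first point at the node
    (0 : 0 : 1); the six others are joined by a line to points in general position. *)
Lemma planar_vanishing (H : mcoord_ring K 3 7) :
  (forall p, on_rnc p -> vanishes_at H p) ->
  forall v : 'M[K]_(7, 4), v 0 (inord 2) != 0 -> (forall i, v i ord_max = 0) ->
  H.@[mxvec v 0] = 0.
Proof.
move=> hH v v0 vpl.
pose B : 'M[K]_4 := \matrix_(i, j) (nth [::] [:: [:: 1; 0; 0; 0];
   [:: 0; 1; 0; 0]; [:: v 0 0; v 0 1; v 0 (inord 2); 0]; [:: 0; 0; 0; 0]] i)`_j.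
have BE a b c d : (\row_j [:: a; b; c; d]`_j : 'rV_4) *m B =
  \row_j [:: a + c * v 0 0; b + c * v 0 1; c * v 0 (inord 2); 0]`_j.
  apply/rowP => j; rewrite !mxE sum_ord_iota /= !big_cons big_nil addr0 !mxE !inordK //=.
  by case: j => [[|[|[|[|//]]]] hj] /=; ring.
pose w k := v (lift 0 k) (inord 2) / v 0 (inord 2).
pose p k := v (lift 0 k) 0 - w k * v 0 0.
pose q k := v (lift 0 k) 1 - w k * v 0 1.
have vB : v = node_config p q w *m B.
  apply/row_matrixP => i; rewrite row_mul rowK.
  have vE : row i v = \row_j [:: v i 0; v i 1; v i (inord 2); 0]`_j.
    apply/rowP => -[[|[|[|[|//]]]] hj]; rewrite !mxE //=.
    - by congr (v _ _); exact: val_inj.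
    - by congr (v _ _); exact: val_inj.
    - by congr (v _ _); apply: val_inj; rewrite /= inordK.
    - by rewrite -[RHS](vpl i); congr (v _ _); exact: val_inj.
  case: unliftP vE => [k ->|->] ->; rewrite BE; apply/rowP => j; rewrite !mxE.
    by case: j => [[|[|[|[|//]]]] hj] /=; rewrite /p /q /w ?addrNK // divfK.
  by case: j => [[|[|[|[|//]]]] hj] /=; rewrite ?mul1r ?add0r.
(* The points (1, a, a^3) are in general position: the conic monomials take the
   values 1, a, a^2, a^3, a^4 there, which form a Vandermonde matrix. *)
have [a ainj] := distinct_elements K 6.
pose L (f g : 'I_6 -> K) t i := (1 - t) * f i + t * g i.
pose X := L p (fun=> 1); pose Y := L q a; pose Z := L w (fun i => a i ^+ 3).
have L1 f g i : L f g 1 i = g i by rewrite /L subrr mul0r add0r mul1r.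
have L0 f g : L f g 0 =1 f by move=> i; rewrite /L subr0 mul0r addr0 mul1r.
pose d t := (\prod_i \prod_(j | j != i) (X t i * Y t j - Y t i * X t j)) *
  \prod_k \det (conic_mx (X t \o lift k) (Y t \o lift k) (Z t \o lift k)).
have pX i : polyfun (X^~ i) by exact: polyfun_line.
have pY i : polyfun (Y^~ i) by exact: polyfun_line.
have pZ i : polyfun (Z^~ i) by exact: polyfun_line.
have pd : polyfun d.
  apply: polyfunM; apply: polyfun_prod => i.
    by apply: polyfun_prod => j; apply: polyfunB; apply: polyfunM.
  apply: polyfun_det => b j.
  case: b => [[|[|[|[|[|//]]]]] hb];
    [ apply: (@eq_polyfun _ (fun t => X t (lift i j) ^+ 2))
    | apply: (@eq_polyfun _ (fun t => X t (lift i j) * Y t (lift i j)))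
    | apply: (@eq_polyfun _ (fun t => Y t (lift i j) ^+ 2))
    | apply: (@eq_polyfun _ (fun t => Z t (lift i j) * X t (lift i j)))
    | apply: (@eq_polyfun _ (fun t => Z t (lift i j) * Y t (lift i j))) ];
    by [move=> t; rewrite mxE | apply: polyfunM | apply: polyfunX].
have d1 : d 1 != 0.
  rewrite mulf_neq0 //; apply/prodf_neq0 => i _.
    apply/prodf_neq0 => j ji.
    by rewrite /X /Y !L1 mul1r mulr1 subr_eq0 (inj_eq ainj).
  rewrite (_ : conic_mx _ _ _ = Vandermonde 5 (\row_j a (lift i j))); last first.
    apply/matrixP => b j; rewrite !mxE /= /X /Y /Z !L1.
    by case: b => [[|[|[|[|[|//]]]]] hb] /=; rewrite ?mulr1 -?exprSr ?expr1n ?mul1r ?expr1.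
  rewrite det_Vandermonde; apply/prodf_neq0 => b _; apply/prodf_neq0 => j bj.
  by rewrite !mxE subr_eq0 (inj_eq ainj) (inj_eq lift_inj) neq_ltn bj orbT.
pose f t := H.@[mxvec (node_config (X t) (Y t) (Z t) *m B) 0].
have pf : polyfun f.
  apply: polyfun_meval => k; case/mxvec_indexP: k => i j.
  apply: (@eq_polyfun _ (fun t => (node_config (X t) (Y t) (Z t) *m B) i j)).
    by move=> t; rewrite mxvecE.
  apply: polyfun_mulmx => i' j'; last exact: polyfun_const.
  case: (unliftP ord0 i') => [k|] Ei'; rewrite Ei'.
    apply: (@eq_polyfun _ (fun t => [:: X t k; Y t k; Z t k; 0]`_j')).
      by move=> t; rewrite !mxE liftK mxE.
    by case: j' => [[|[|[|[|//]]]] hj'] //=; exact: polyfun_const.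
  apply: (@eq_polyfun _ (fun t => [:: 0; 0; 1; 0]`_j')); last exact: polyfun_const.
  by move=> t; rewrite !mxE unlift_none mxE.
have key t : d t != 0 -> f t = 0.
  rewrite mulf_eq0 negb_or => /andP[/prodf_neq0 dw /prodf_neq0 dc].
  have [|k|A [xi [l [l0 E]]]] := @nodal_cubic_param (X t) (Y t) (Z t).
  - by move=> i j ij; have /prodf_neq0/(_ j) := dw i isT; rewrite eq_sym; exact.
  - exact: dc.
  rewrite /f E -[RHS](vanishing_extends hH xi (A *m B) l0).
  congr (H.@[mxvec _ 0]).
  by apply/row_matrixP => i; rewrite row_mul !rowK -scalemxAl mulmxA.
have := polyfun_density pf pd d1 key 0; rewrite /f vB.
rewrite (_ : node_config (X 0) _ _ = node_config p q w) //.
by apply/row_matrixP => i; rewrite !rowK; case: unliftP => // k _; rewrite /X /Y /Z !L0.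
Qed.

End DegenerateCubics.

(** * Digits and the count of monomials *)

Section Digits.

Definition digit (N k m : nat) : nat := (m %/ N ^ k) %% N.

Lemma digit_expansion N r m : 0 < N ->
  \sum_(k < r) digit N k m * N ^ k = m %% N ^ r.
Proof.
move=> N0; elim: r => [|r IH]; first by rewrite big_ord0 modn1.
rewrite big_ord_recr /= IH /digit expnS.
set q := N ^ r; have q0 : 0 < q by rewrite expn_gt0 N0.
rewrite addnC; have mE := divn_eq m q; rewrite {1}(divn_eq (m %/ q) N) mulnDl -mulnA -addnA in mE.
rewrite [in RHS]mE modnMDl [in RHS]modn_small //.
apply: (@leq_trans (((m %/ q) %% N).+1 * q)).
  by rewrite mulSn addnC ltn_add2r ltn_pmod.
by rewrite leq_mul2r ltn_pmod ?orbT.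
Qed.

(** Grouping the digits two by two matches the two affine coordinates of each
    point. *)
Lemma digit_expansion_pairs N n m : 0 < N -> m < N ^ n.*2 ->
  \sum_(i < n) (digit N i.*2 m * N ^ i.*2 + digit N i.*2.+1 m * N ^ i.*2.+1) = m.
Proof.
move=> N0 mN; rewrite -[RHS](modn_small mN) -digit_expansion //.
elim: n {mN} => [|n IH]; first by rewrite !big_ord0.
by rewrite big_ord_recr doubleS 2!big_ord_recr /= IH addnA.
Qed.

Lemma ltn_digit N k m : 0 < N -> digit N k m < N.
Proof. exact: ltn_pmod. Qed.

(** The left-hand side bounds the number of monomials in the n + 8 parameters, the
    right-hand side is the number of monomials in 2n coordinates.  As n >= 9, the
    exponent of N on the right is the larger one, and N absorbs the constants. *)
Lemma counting n N : 9 <= n -> N = ((9 * n) ^ (n + 8)).+1 ->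
  (8 * N * n).+1 ^ (n + 8) < N ^ n.*2.
Proof.
move=> n9 EN.
have H1 : (8 * N * n).+1 ^ (n + 8) <= (9 * n * N) ^ (n + 8) by rewrite leq_exp2r; nia.
apply: leq_ltn_trans H1 _; rewrite expnMn.
have H2 : N * N ^ (n + 8) <= N ^ n.*2 by rewrite -expnS leq_pexp2l; lia.
apply: leq_trans H2; rewrite ltn_pmul2r ?EN //.
by rewrite expn_gt0.
Qed.

End Digits.

(** * Linear dependence of polynomials of bounded degree *)

Section Dependence.
Local Open Scope ring_scope.
Variable K : closedFieldType.

(** There are at most (d + 1)^r monomials of degree at most d in r variables. *)
Lemma mpoly_dependent (r d M : nat) (g : 'I_M -> {mpoly K[r]}) :
  (forall m, msize (g m) <= d.+1)%N -> (d.+1 ^ r < M)%N ->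
  exists2 c : 'rV[K]_M, c != 0 & \sum_m c 0 m *: g m = 0.
Proof.
move=> hg hM; pose T := {ffun 'I_r -> 'I_d.+1}.
pose mu (t : T) := [multinom (t l : nat) | l < r].
pose G : 'M[K]_(M, #|T|) := \matrix_(m, k) (g m)@_(mu (enum_val k)).
have [|c c0 cG] := left_kernel_nontrivial G; first by rewrite card_ffun !card_ord.
exists c => //; apply/mpolyP => w; rewrite mcoeff0 raddf_sum /=.
have [wd|dw] := leqP (mdeg w) d; last first.
  apply: big1 => m _; rewrite mcoeffZ; apply/eqP; rewrite mulf_eq0 mcoeff_eq0 orbC.
  by rewrite msize_mdeg_ge // (leq_trans (hg m)).
pose t : T := [ffun l => inord (w l)].
have -> : w = mu t.
  apply/mnmP => l; rewrite mnmE ffunE inordK // ltnS.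
  by apply: leq_trans wd; rewrite mdegE (bigD1 l) //= leq_addr.
have := congr1 (fun R : 'rV_#|T| => R 0 (enum_rank t)) cG; rewrite !mxE => c0t.
rewrite -[RHS]c0t.
by apply: eq_bigr => m _; rewrite mcoeffZ mxE enum_rankK.
Qed.

Definition degree_le r d (p : {mpoly K[r]}) := (msize p <= d.+1)%N.

Lemma degree_leM r a b (p q : {mpoly K[r]}) :
  degree_le a p -> degree_le b q -> degree_le (a + b) (p * q).
Proof.
rewrite /degree_le => pa qb.
have [->|p0] := eqVneq p 0; first by rewrite mul0r msize0.
have [->|q0] := eqVneq q 0; first by rewrite mulr0 msize0.
rewrite msizeM // -[(a + b).+1]/((a + b).+2.-1) -addSn -addnS.
by rewrite -!subn1 leq_sub2r // leq_add.
Qed.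

Lemma degree_le1 r a : @degree_le r a 1.
Proof. by rewrite /degree_le msize1. Qed.

Lemma degree_le0 r a : @degree_le r a 0.
Proof. by rewrite /degree_le msize0. Qed.

Lemma degree_leX r a k (p : {mpoly K[r]}) :
  degree_le a p -> degree_le (a * k) (p ^+ k).
Proof.
move=> pa; elim: k => [|k IH]; first by rewrite expr0 degree_le1.
by rewrite exprS mulnS; apply: degree_leM.
Qed.

Lemma degree_leD r a (p q : {mpoly K[r]}) :
  degree_le a p -> degree_le a q -> degree_le a (p + q).
Proof.
rewrite /degree_le => pa qa; apply: leq_trans (mmeasureD_le _ _ _) _.
by rewrite geq_max pa.
Qed.

Lemma degree_le_sum r a (I : finType) (f : I -> {mpoly K[r]}) :
  (forall i, degree_le a (f i)) -> degree_le a (\sum_i f i).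
Proof.
by move=> h; apply: (big_ind (@degree_le r a)) => [|p q|i _];
   [exact: degree_le0 | exact: degree_leD | exact: h].
Qed.

Lemma degree_le_prod r a n (f : 'I_n -> {mpoly K[r]}) :
  (forall i, degree_le a (f i)) -> degree_le (a * n) (\prod_i f i).
Proof.
elim: n f => [|n IH] f h; first by rewrite big_ord0 degree_le1.
by rewrite big_ord_recl mulnS; apply: degree_leM => //; apply: IH.
Qed.

Lemma meval_multimonomial n d (E : 'M[nat]_(n, d)) (v : 'M[K]_(n, d)) :
  'X_[[multinom mxvec E 0%R k | k < (n * d)%N]].@[mxvec v 0] = \prod_i \prod_j v i j ^+ E i j.
Proof.
rewrite mevalX (reindex _ (curry_mxvec_bij _ _)) pair_bigA /=.
by apply: eq_bigr => -[i j] _; rewrite mnmE !mxvecE.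
Qed.

End Dependence.

(** * Normal form of points on a twisted cubic *)

Section Gauge.
Local Open Scope ring_scope.
Variable K : closedFieldType.

Definition pair2 (s t : K) : 'rV[K]_2 := \row_j (if j == 0 then s else t).

Lemma pair2E s t : (pair2 s t 0 0 = s) * (pair2 s t 0 1 = t).
Proof. by split; rewrite mxE. Qed.

(** Binary cubic forms are stable under linear substitutions: B is the matrix of
    the symmetric cube of the substitution with rows x and y. *)
Lemma veronese_pencil (x y : 'rV[K]_2) : exists B : 'M[K]_4,
  forall s t, veronese 3 (s *: x + t *: y) = veronese 3 (pair2 s t) *m B.
Proof.
pose a := x 0 0; pose b := x 0 1; pose c := y 0 0; pose d := y 0 1.
exists (\matrix_(i, j) (nth [::]
  [:: [:: a ^+ 3; a ^+ 2 * b; a * b ^+ 2; b ^+ 3];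
      [:: 3 * a ^+ 2 * c; a ^+ 2 * d + 2 * a * b * c; 2 * a * b * d + b ^+ 2 * c; 3 * b ^+ 2 * d];
      [:: 3 * a * c ^+ 2; 2 * a * c * d + b * c ^+ 2; a * d ^+ 2 + 2 * b * c * d; 3 * b * d ^+ 2];
      [:: c ^+ 3; c ^+ 2 * d; c * d ^+ 2; d ^+ 3]] i)`_j) => s t.
apply/rowP => j; rewrite veronese_entries [in RHS]mxE sum_ord_iota /= !big_cons big_nil addr0.
rewrite !veronese_entries !pair2E !mxE !inordK //= -/a -/b -/c -/d.
by case: j => [[|[|[|[|//]]]] hj] /=; ring.
Qed.

Lemma wedge_expand (x y v : 'rV[K]_2) : wedge x y != 0 ->
  v = (wedge v y / wedge x y) *: x + (wedge x v / wedge x y) *: y.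
Proof.
move=> w0; apply: rV2P; rewrite !mxE; move: w0; rewrite /wedge => w0; field; exact: w0.
Qed.

(** Parameters of the points after three of them have been moved to (1 : 0),
    (0 : 1) and (1 : 1). *)
Definition frame_param (R : nzRingType) (tau : nat -> R) (i : nat) : R * R :=
  match i with 0 => (1, 0) | 1 => (0, 1) | 2 => (1, 1) | _ => (1, tau i) end.

Lemma frame_normalization n (x : 'I_n.+3 -> 'rV[K]_2) :
  (forall i j, i != j -> wedge (x i) (x j) != 0) ->
  exists (u v : 'rV[K]_2) (mu : 'I_n.+3 -> K) (tau : nat -> K),
    (forall i, x i = mu i *: ((frame_param tau i).1 *: u + (frame_param tau i).2 *: v)).
Proof.
move=> xw; pose i1 := inord 1 : 'I_n.+3; pose i2 := inord 2 : 'I_n.+3.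
have w01 : wedge (x 0) (x i1) != 0 by apply: xw; rewrite -val_eqE /= inordK.
have w02 : wedge (x 0) (x i2) != 0 by apply: xw; rewrite -val_eqE /= inordK.
have w21 : wedge (x i2) (x i1) != 0 by apply: xw; rewrite -val_eqE /= !inordK.
pose a := wedge (x i2) (x i1) / wedge (x 0) (x i1).
pose b := wedge (x 0) (x i2) / wedge (x 0) (x i1).
have a0 : a != 0 by rewrite mulf_neq0 ?invr_eq0.
have b0 : b != 0 by rewrite mulf_neq0 ?invr_eq0.
pose s i := wedge (x i) (x i1) / wedge (x 0) (x i1).
pose t i := wedge (x 0) (x i) / wedge (x 0) (x i1).
have xE i : x i = s i *: x 0 + t i *: x i1 by exact: wedge_expand.
pose mu (i : 'I_n.+3) := match val i with 0 => a^-1 | 1 => b^-1 | 2 => 1 | _ => s i / a end.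
(* The factors a and b make the third point the sum of the two basis vectors. *)
exists (a *: x 0), (b *: x i1), mu, (fun k => t (inord k) * a / (s (inord k) * b)) => i.
rewrite /mu; case: i => [[|[|[|k]]] hk] /=.
- by rewrite scale0r scale1r addr0 scalerA mulVf // scale1r; congr x; exact: val_inj.
- rewrite scale0r scale1r add0r scalerA mulVf // scale1r; congr x; apply: val_inj.
  by rewrite /= inordK.
- rewrite !scale1r -/(a *: x 0 + b *: x i1) -xE; congr x; apply: val_inj.
  by rewrite /= inordK.
set i := Ordinal hk; have -> : inord k.+3 = i by apply: val_inj; rewrite /= inordK.
have si : s i != 0.
  by rewrite mulf_neq0 ?invr_eq0 //; apply: xw; rewrite -val_eqE /= inordK.
rewrite {1}(xE i) scale1r scalerDr !scalerA.
by congr (_ *: _ + _ *: _); field; rewrite ?a0 ?b0 ?si.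
Qed.

End Gauge.

(** * A form vanishing on the configurations carried by twisted cubics *)

Section Relation.
Local Open Scope ring_scope.
Variable K : closedFieldType.

(** The monomial numbered m, of degree 2N in each point: the digits of m are its
    exponents in the first two coordinates and the third coordinate completes the
    degree; as digits are less than N, the subtractions are not truncated.  It is
    written over any ring so that it applies both to coordinates and to their
    expressions in the parameters. *)
Definition digit_monomial (R : comNzRingType) (N n : nat) (y : 'I_n -> nat -> R) (m : nat) : R :=
  \prod_(i < n) (y i 0%N ^+ digit N i.*2 m * y i 1%N ^+ digit N i.*2.+1 m *
                 y i 2%N ^+ (N.*2 - digit N i.*2 m - digit N i.*2.+1 m)).

Lemma digit_monomialZ (R : comNzRingType) (N n : nat) (y z : 'I_n -> nat -> R) (r : 'I_n -> R) m :
  (0 < N)%N -> (forall i k, (k < 3)%N -> z i k = r i * y i k) ->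
  digit_monomial N z m = (\prod_i r i ^+ N.*2) * digit_monomial N y m.
Proof.
move=> N0 zy; rewrite /digit_monomial -big_split; apply: eq_bigr => i _ /=.
rewrite !zy // !exprMn.
have := ltn_digit i.*2 m N0; have := ltn_digit i.*2.+1 m N0.
set a := digit N i.*2 m; set b := digit N i.*2.+1 m => bN aN.
have -> : r i ^+ N.*2 = r i ^+ a * r i ^+ b * r i ^+ (N.*2 - a - b).
  by rewrite -!exprD; congr (_ ^+ _); lia.
ring.
Qed.

Lemma eq_digit_monomial (R : comNzRingType) (N n : nat) (y z : 'I_n -> nat -> R) m :
  (forall i k, (k < 3)%N -> z i k = y i k) -> digit_monomial N z m = digit_monomial N y m.
Proof. by move=> zy; apply: eq_bigr => i _; rewrite !zy. Qed.

Lemma degree_leW r a b (p : {mpoly K[r]}) : (a <= b)%N -> degree_le a p -> degree_le b p.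
Proof. by move=> ab pa; apply: leq_trans pa _. Qed.

(** The first three coordinates of the normalized points are polynomials of degree
    at most 4 in n + 11 variables, which are here the entries of the first three
    columns of D other than D 0 0, followed by the free parameters tau.  Hence the
    monomials become polynomials of degree at most 8N(n + 3), and there are too
    many of them to be independent. *)
Lemma twisted_cubic_relation (n N : nat) :
  ((8 * N * n.+3).+1 ^ (n + 10).+1 < N ^ n.+3.*2)%N ->
  exists2 c : 'rV[K]_(N ^ n.+3.*2), c != 0 &
    forall (D : 'M[K]_4) (tau : nat -> K), D 0 0 = 1 ->
    \sum_m c 0 m * digit_monomial N (fun (i : 'I_n.+3) k =>
       (veronese 3 (pair2 (frame_param tau i).1 (frame_param tau i).2) *m D) 0 (inord k)) m = 0.
Proof.
move=> hN.
have N0 : (0 < N)%N by case: N hN.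
pose T k : {mpoly K[(n + 10).+1]} := 'X_(inord (k + 8)).
pose BX l k : {mpoly K[(n + 10).+1]} := if (3 * l + k)%N is h.+1 then 'X_(inord h) else 1.
pose S (i : nat) := (frame_param T i).1; pose U (i : nat) := (frame_param T i).2.
pose Y (i : 'I_n.+3) k := \sum_(l < 4) S i ^+ (3 - l) * U i ^+ l * BX l k.
have dS i : degree_le 0 (S i) by case: i => [|[|[|i]]]; rewrite /S /= ?degree_le1 ?degree_le0.
have dX h : degree_le 1 ('X_h : {mpoly K[(n + 10).+1]}) by rewrite /degree_le msizeX mdeg1.
have dU i : degree_le 1 (U i) by case: i => [|[|[|i]]]; rewrite /U /= ?degree_le1 ?degree_le0 ?dX.
have dB l k : degree_le 1 (BX l k).
  by rewrite /BX; case: (3 * l + k)%N => [|h]; rewrite ?degree_le1 ?dX.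
have dY i k : degree_le 4 (Y i k).
  apply: degree_le_sum => l.
  apply: (@degree_leW _ (0 * (3 - l) + 1 * l + 1)%N); first by have := ltn_ord l; lia.
  by apply: degree_leM => //; apply: degree_leM; apply: degree_leX.
have dm (m : 'I_(N ^ n.+3.*2)) : (msize (digit_monomial N Y m) <= (8 * N * n.+3).+1)%N.
  apply: degree_le_prod => i.
  set a := digit N _ m; set b := digit N _ m.
  apply: (@degree_leW _ (4 * a + 4 * b + 4 * (N.*2 - a - b))%N).
    by have := ltn_digit i.*2 m N0; have := ltn_digit i.*2.+1 m N0; rewrite -/a -/b; lia.
  by apply: degree_leM; [apply: degree_leM|]; apply: degree_leX.
have [c c0 hc] := mpoly_dependent dm hN.
exists c => // D tau D1.
(* Variable h < 11 stands for the entry of D in row (h + 1) / 3 and column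
   (h + 1) mod 3, variable k + 8 for the parameter of the point k >= 3. *)
pose e (h : 'I_(n + 10).+1) : K :=
  if (h < 11)%N then D (inord (h.+1 %/ 3)) (inord (h.+1 %% 3)) else tau (h - 8)%N.
have eB (l : 'I_4) k : (k < 3)%N -> (BX l k).@[e] = D l (inord k).
  move=> k3; have l4 := ltn_ord l; rewrite /BX; case E: (3 * l + k)%N => [|h].
    have -> : l = 0 by apply: val_inj => /=; lia.
    have -> : inord k = 0 :> 'I_4 by apply: val_inj; rewrite /= inordK; lia.
    by rewrite meval1 D1.
  rewrite mevalXU /e inordK; last by lia.
  rewrite (_ : (h < 11)%N); last by lia.
  rewrite -E mulnC divnMDl // modnMDl divn_small // modn_small // addn0.
  by rewrite inord_val.
have eS i : (S i).@[e] = (frame_param tau i).1.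
  by case: i => [|[|[|i]]]; rewrite /S /= ?meval0 ?meval1.
have eU (i : 'I_n.+3) : (U i).@[e] = (frame_param tau i).2.
  case: i => [[|[|[|i]]] hi]; rewrite /U /= ?meval0 ?meval1 //.
  rewrite mevalXU /e inordK; last by lia.
  rewrite (_ : (_ < 11)%N = false); last by lia.
  by rewrite addnK.
have eY (i : 'I_n.+3) k : (k < 3)%N ->
    (veronese 3 (pair2 (frame_param tau i).1 (frame_param tau i).2) *m D) 0 (inord k) =
    (Y i k).@[e].
  move=> k3; rewrite mxE /Y raddf_sum; apply: eq_bigr => l _.
  by rewrite /= !mevalM !rmorphXn /= eS eU eB // mxE !pair2E.
have := congr1 (meval e) hc; rewrite meval0 raddf_sum /= => E0; rewrite -[RHS]E0.
apply: eq_bigr => m _; rewrite mevalZ; congr (_ * _).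
rewrite (eq_digit_monomial _ _ eY) /digit_monomial rmorph_prod; apply: eq_bigr => i _.
by rewrite /= !mevalM !rmorphXn.
Qed.

(** The automorphisms of the projective line and the rescaling of the points bring
    any configuration to the normal form with D 0 0 = 1, except when the first
    coordinate of the first point is zero. *)
Lemma on_rnc_relation (n N : nat) (c : 'rV[K]_(N ^ n.+3.*2)) : (0 < N)%N ->
  (forall (D : 'M[K]_4) (tau : nat -> K), D 0 0 = 1 ->
    \sum_m c 0 m * digit_monomial N (fun (i : 'I_n.+3) k =>
       (veronese 3 (pair2 (frame_param tau i).1 (frame_param tau i).2) *m D) 0 (inord k)) m = 0) ->
  forall (p : multiproj K 3 n.+3) (v : 'M[K]_(n.+3, 4)), on_rnc p ->
  (forall i, has_coords (p i) (row i v)) -> v 0 0 != 0 ->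
  \sum_m c 0 m * digit_monomial N (fun i k => v i (inord k)) m = 0.
Proof.
move=> N0 hc p v /on_rncP[A [x [x0 xw xA]]] pv v0.
have [u [w [mu [tau xE]]]] := frame_normalization xw.
have [B hB] := veronese_pencil u w.
have [l hl] : exists l : 'I_n.+3 -> K, forall i,
    l i != 0 /\ row i v = l i *: (veronese 3 (x i) *m A).
  by apply: (@fin_all_exists _ _ (fun i l => l != 0 /\ row i v = l *: (veronese 3 (x i) *m A))) => i;
    have [k k0 ->] := has_coords_prop (xA i) (pv i); exists k.
pose D := B *m A.
pose xi i := pair2 (frame_param tau i).1 (frame_param tau i).2.
have vE (i : 'I_n.+3) : row i v = (l i * mu i ^+ 3) *: (veronese 3 (xi i) *m D).
  by rewrite (hl i).2 {1}(xE i) veroneseZ hB -scalemxAl scalerA mulmxA.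
have D0 : D 0 0 != 0.
  apply: contraNneq v0 => D0.
  have := congr1 (fun r : 'rV_4 => r 0 0) (vE 0); rewrite !mxE => ->.
  rewrite big_ord_recl big1 ?addr0; last first.
    by move=> j _; rewrite mxE /xi !pair2E /= expr0n mulr0 mul0r.
  by rewrite D0 !mulr0.
have Dn1 : ((D 0 0)^-1 *: D) 0 0 = 1 by rewrite mxE mulVf.
have E m : digit_monomial N (fun i k => v i (inord k)) m =
    (\prod_i (l i * mu i ^+ 3 * D 0 0) ^+ N.*2) * digit_monomial N (fun (i : 'I_n.+3) k =>
       (veronese 3 (xi i) *m ((D 0 0)^-1 *: D)) 0 (inord k)) m.
  apply: digit_monomialZ => // i k _.
  have Ev : v i (inord k) = l i * mu i ^+ 3 * (veronese 3 (xi i) *m D) 0 (inord k).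
    by have := congr1 (fun r : 'rV_4 => r 0 (inord k)) (vE i); rewrite [LHS]mxE [RHS]mxE.
  by rewrite Ev -scalemxAr [X in _ = _ * X]mxE -!mulrA mulVKf.
under eq_bigr do rewrite E mulrCA.
by rewrite -mulr_sumr hc // mulr0.
Qed.

(** The first exponent is shifted by one, so that the form is divisible by the
    first coordinate of each point: it thus also vanishes on the configurations
    that escape the normalization D 0 0 = 1. *)
Definition witness_exponents (n N m : nat) : 'M[nat]_(n, 4) :=
  \matrix_(i, j) nth 0%N [:: (digit N i.*2 m).+1; digit N i.*2.+1 m;
                    N.*2 - digit N i.*2 m - digit N i.*2.+1 m]%N j.

Definition witness_form (n N : nat) (c : 'rV[K]_(N ^ n.*2)) : mcoord_ring K 3 n :=
  \sum_m c 0 m *: 'X_[[multinom mxvec (witness_exponents n N m) 0%R k | k < (n * 4)%N]].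

Lemma meval_witness_form n N (c : 'rV[K]_(N ^ n.*2)) (v : 'M[K]_(n, 4)) :
  (witness_form c).@[mxvec v 0] =
  (\prod_i v i 0) * \sum_m c 0 m * digit_monomial N (fun i k => v i (inord k)) m.
Proof.
rewrite raddf_sum mulr_sumr; apply: eq_bigr => m _.
rewrite /= mevalZ meval_multimonomial mulrCA; congr (_ * _).
rewrite -big_split; apply: eq_bigr => i _ /=.
pose W i k := v i (inord k) ^+ witness_exponents n N m i (inord k).
transitivity (W i 0%N * W i 1%N * W i 2%N * W i 3%N).
  transitivity (\prod_(j < 4) W i j); first by apply: eq_bigr => j _; rewrite /W inord_val.
  by rewrite !big_ord_recr big_ord0 /= mul1r.
have z0 : inord 0 = 0 :> 'I_4 by apply: val_inj; rewrite /= inordK.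
rewrite /W !mxE !inordK //= expr0 mulr1 exprS !mulrA.
by rewrite z0.
Qed.

Lemma witness_form_multihomogeneous n N (c : 'rV[K]_(N ^ n.*2)) : (0 < N)%N ->
  multihomogeneous (witness_form c).
Proof.
move=> N0; exists (fun=> N.*2.+1) => mu /msupp_sum_le /flattenP[s /mapP[m _ ->]].
move/msuppZ_le; rewrite msuppX inE => /eqP -> i.
under eq_bigr do rewrite mnmE mxvecE mxE.
rewrite !big_ord_recl big_ord0 /=.
have := ltn_digit i.*2 m N0; have := ltn_digit i.*2.+1 m N0; lia.
Qed.

End Relation.

(** * The planar counterexample *)

Section Final.
Local Open Scope ring_scope.
Variable K : closedFieldType.

Lemma pulled_back_zero n (p : multiproj K 3 n) (q : 'M[K]_(n, 4)) :
  (forall i, has_coords (p i) (row i q)) ->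
  (forall i, q i (inord 2) != 0) -> (forall i, q i ord_max = 0) ->
  zero_locus (@pulled_back_equations K 3 n 7 (@veronese_compactification K 3 7)) p.
Proof.
move=> pq q2 q3 _ [J [hJ [F [_ hF ->]]]]; apply/vanishes_at_pullback => v hv.
have vk a : exists2 k, k != 0 & forall j, v a j = k * q (Defs.nth_index hJ a) j.
  have := hv a; rewrite ffunE => /(has_coords_prop (pq (Defs.nth_index hJ a)))[k k0 vE].
  exists k => // j; have := congr1 (fun r : 'rV_4 => r 0 j) vE.
  by rewrite !mxE.
apply: planar_vanishing => [r rU||a].
- by apply: hF => Z _; apply.
- by have [k k0 ->] := vk 0; rewrite mulf_neq0.
- by have [k _ ->] := vk a; rewrite q3 mulr0.
Qed.

(** Substituting these powers of u in digit_monomial is Kronecker's substitution: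
    distinct monomials become distinct powers of u. *)
Definition digit_point (n N : nat) (u : K) : 'M[K]_(n, 4) :=
  \matrix_(i, j) [:: u ^+ (N ^ i.*2); u ^+ (N ^ i.*2.+1); 1; 0]`_j.

Lemma digit_monomial_point n N u m : (0 < N)%N -> (m < N ^ n.*2)%N ->
  digit_monomial N (fun i k => digit_point n N u i (inord k)) m = u ^+ m.
Proof.
move=> N0 mN; rewrite -[in RHS](digit_expansion_pairs N0 mN) -prodrXr.
apply: eq_bigr => i _; rewrite !mxE !inordK //= expr1n mulr1 -!exprM -exprD.
by rewrite mulnC [(N ^ _.+1 * _)%N]mulnC.
Qed.

Lemma counterexample n (hn : (9 <= n)%N) :
  exists2 p : multiproj K 3 n,
    zero_locus (@pulled_back_equations K 3 n 7 (@veronese_compactification K 3 7)) p &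
    ~ @veronese_compactification K 3 n p.
Proof.
case: n hn => [|[|[|n]]] // hn.
pose N := ((9 * n.+3) ^ (n.+3 + 8)).+1.
have N0 : (0 < N)%N by [].
have cnt : ((8 * N * n.+3).+1 ^ (n + 10).+1 < N ^ n.+3.*2)%N.
  by have := counting hn (erefl N); rewrite (_ : n.+3 + 8 = (n + 10).+1)%N //; lia.
have [c c0 hc] := twisted_cubic_relation K cnt.
(* The factor 'X ensures u != 0, hence that the first coordinates do not vanish. *)
have [u] : exists u, ~~ root ('X * rVpoly c) u.
  apply/closed_nonrootP; rewrite mulf_neq0 ?polyX_eq0 //.
  by apply: contraNneq c0 => c0; rewrite -(rVpolyK c) c0 linear0.
rewrite /root hornerM hornerX mulf_eq0 negb_or => /andP[u0 Pu].
pose q := digit_point n.+3 N u.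
have q2 i : q i (inord 2) = 1 by rewrite mxE inordK.
have q3 i : q i ord_max = 0 by rewrite mxE.
have [p hp] : exists p : 'I_n.+3 -> pspace K 3, forall i, has_coords (p i) (row i q).
  apply: (@fin_all_exists _ _ (fun i y => has_coords y (row i q))) => i.
  apply: exists_point; apply: contraTneq (oner_neq0 K) => qi.
  by have := congr1 (fun r : 'rV_4 => r 0 (inord 2)) qi; rewrite [LHS]mxE q2 mxE => ->; rewrite eqxx.
exists (finfun p).
  apply: (@pulled_back_zero _ _ q) => [i|i|i] //; first by rewrite ffunE.
  by rewrite q2 oner_neq0.
move=> pV; have /(_ _ erefl q) : zero_locus (fun F => F = witness_form c) (finfun p).
  apply: pV => [|r rU F -> v rv].
    exists (fun F => F = witness_form c); split=> [F ->|r] //.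
    exact: witness_form_multihomogeneous.
  rewrite meval_witness_form.
  have [v0|v0] := eqVneq (v 0 0) 0; first by rewrite (bigD1 ord0) //= v0 !mul0r.
  by rewrite (on_rnc_relation N0 hc rU rv v0) mulr0.
move=> Fq; suff /eqP : (witness_form c).@[mxvec q 0] != 0.
  by apply; apply: Fq => i; rewrite ffunE.
rewrite meval_witness_form mulf_neq0 //.
  by apply/prodf_neq0 => i _; rewrite mxE expf_neq0.
apply: contraNneq Pu => Pu; rewrite -[X in _ == X]Pu horner_poly; apply/eqP/eq_bigr => m _.
by rewrite digit_monomial_point // valK.
Qed.

End Final.

Theorem corollary4p27 (K : closedFieldType) (n : nat) (hn : 9 <= n) :
  ~ (forall p : multiproj K 3 n,
       zero_locus
         (@pulled_back_equations K 3 n 7 (@veronese_compactification K 3 7)) p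
       <-> @veronese_compactification K 3 n p).
Proof.
have [p pW pV] := counterexample K hn.
by move/(_ p)/iffLR/(_ pW).
Qed.
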